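(* Let $G>I$ be a finite group with $Z(G)=I$ and $\sigma_1,\sigma_2\in G$ with $G=\langle\sigma_1,\sigma_2\rangle$, $o(\sigma_1\sigma_2\sigma_1)=2$, $\sigma_1\sigma_2\sigma_1=\sigma_2\sigma_1\sigma_2$, $C=[\sigma_1]$, $D=[\sigma_2\sigma_1]$, and $[\underline{\sigma}]=[\sigma_1,\sigma_2,\sigma_1,\sigma_1,\sigma_2\sigma_1]$. Then $Z_9=[\underline{\sigma}]^{B_5}\subseteq\Sigma^i(C,C,C,C,D)$ is an orbit of length $9$ under the action of $B_5$ such that $\rho_5(\beta_{ij})$ has cycle type $(1)^3(3)^2$ for $1\le i<j\le 4$, $\rho_5(\beta_{i5})$ has cycle type $(1)(2)^4$ for $1\le i<5$, $\rho_5(B_5)\cong((C_3\times C_3)\rtimes Q_8)\rtimes C_3$, and the genus is $g_{Z_9}=0$.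
   Context: $\iota$ is the identity and $I$ the trivial group; $Q_8$ is the quaternion group of order $8$. For conjugacy classes $C_1,\dots,C_m$, $\Sigma^i(C_1,\dots,C_m)$ is the set of $G$-conjugacy classes $[\sigma_1,\dots,\sigma_m]$ (simultaneous conjugation) of tuples with $\sigma_j\in C_j$, $\langle\sigma_1,\dots,\sigma_m\rangle=G$, $\sigma_1\cdots\sigma_m=\iota$. The Hurwitz braid group $H_m$ generated by $\beta_2,\dots,\beta_m$ acts from the right by $[\underline{\sigma}]^{\beta_i}=[\sigma_1,\dots,\sigma_{i-2},\sigma_{i-1}\sigma_i\sigma_{i-1}^{-1},\sigma_{i-1},\sigma_{i+1},\dots,\sigma_m]$. The pure braid group $B_m$ is generated by $\beta_{ij}=\beta_{i+1}^{-1}\cdots\beta_{j-1}^{-1}\beta_j^2\beta_{j-1}\cdots\beta_{i+1}$, $1\le i<j\le m$, and $\rho_m$ is the induced permutation representation on the orbit. For a $B_m$-orbit $Z$, $g_Z=1-|Z|+\frac12\big((m-1)|Z|-\sum_{j=2}^m z_{1j}\big)$ with $z_{1j}$ the number of cycles (fixed points included) of $\rho_m(\beta_{1j})$ on $Z$. *)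

(* Defs.v *)
From HB Require Import structures.
From mathcomp Require Import all_boot all_order all_algebra all_fingroup all_solvable.
Set Implicit Arguments. Unset Strict Implicit. Unset Printing Implicit Defensive.
Import GroupScope.

(* Tuples (sigma_1,...,sigma_m) are finite functions
   {ffun 'I_m -> gT}; position k (0-indexed) holds sigma_(k+1). *)

Section Braid.
Variables (gT : finGroupType) (m : nat).
Local Notation tup := {ffun 'I_m -> gT}.

Definition at_ (t : tup) (n : nat) : gT :=
  if insub n is Some i then t i else 1.

(* Hurwitz generator beta_(k+2) acting on tuples (0-indexed positions k,k+1):
   (.., s_k, s_(k+1), ..) |-> (.., s_k s_(k+1) s_k^-1, s_k, ..);
   identity if k+1 is out of range (never used there). *)
Definition bstep (k : nat) (t : tup) : tup :=
  if k.+1 < m then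
    [ffun i : 'I_m => if val i == k then at_ t k * at_ t k.+1 * (at_ t k)^-1
                      else if val i == k.+1 then at_ t k else t i]
  else t.

Definition bstepV (k : nat) (t : tup) : tup :=
  if k.+1 < m then
    [ffun i : 'I_m => if val i == k then at_ t k.+1
                      else if val i == k.+1 then (at_ t k.+1)^-1 * at_ t k * at_ t k.+1
                      else t i]
  else t.

Lemma at_E (t : tup) (i : 'I_m) : at_ t (val i) = t i.
Proof. by rewrite /at_ valK. Qed.

Lemma bstepK k : cancel (bstep k) (bstepV k).
Proof.
move=> t; rewrite /bstep /bstepV; case: ifP => km; rewrite km //.
have k0 : k < m by apply: ltnW.
have nkk : (k.+1 == k) = false by elim: k {km k0}.
apply/ffunP => i; rewrite !ffunE.
rewrite !(at_E _ (Ordinal km)) !(at_E _ (Ordinal k0)) !ffunE /= eqxx nkk.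
case: eqP => [ik|nik]; first by have -> : i = Ordinal k0 by apply: val_inj.
case: eqP => [ik|_]; last by [].
rewrite eqxx !mulgA mulVg mul1g -mulgA mulVg mulg1.
by have -> : i = Ordinal km by apply: val_inj.
Qed.

Lemma bstep_inj k : injective (bstep k).
Proof. exact: can_inj (bstepK k). Qed.

Lemma bstepV_inj k : injective (bstepV k).
Proof.
move=> t u; rewrite /bstepV; case: ifP => // km E.
have k0 : k < m by apply: ltnW.
have nkk : (k.+1 == k) = false by elim: k {km k0 E}.
have F := congr1 (fun f : tup => f (Ordinal k0)) E.
have F1 := congr1 (fun f : tup => f (Ordinal km)) E.
rewrite /= !ffunE /= eqxx in F; rewrite /= !ffunE /= eqxx nkk in F1.
rewrite F in F1; move/mulIg/mulgI in F1.
apply/ffunP => i; move/ffunP: E => /(_ i); rewrite !ffunE.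
case: eqP => [ik|_].
  by move=> _; rewrite -(at_E t) -(at_E u) ik.
case: eqP => [ik|_] // _.
by rewrite -(at_E t) -(at_E u) ik.
Qed.

(* Pure braid generator beta_ij (1 <= i < j <= m), acting from the right:
   beta_ij = beta_(i+1)^-1 ... beta_(j-1)^-1 beta_j^2 beta_(j-1) ... beta_(i+1),
   the leftmost factor being applied first.  beta_l is bstep (l-2). *)
Definition pure_tup (i j : nat) (t : tup) : tup :=
  let ls := iota i.+1 (j - i.+1) in
  let t1 := foldl (fun u l => bstepV (l - 2) u) t ls in
  let t2 := bstep (j - 2) (bstep (j - 2) t1) in
  foldl (fun u l => bstep (l - 2) u) t2 (rev ls).

Lemma foldl_inj (f : nat -> tup -> tup) (s : seq nat) :
  (forall l, injective (f l)) -> injective (fun t => foldl (fun u l => f l u) t s).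
Proof.
move=> fi; elim: s => [|l s IH] //= x y /IH; exact: fi.
Qed.

Lemma pure_tup_inj i j : injective (pure_tup i j).
Proof.
move=> x y; rewrite /pure_tup.
move/(@foldl_inj (fun l => bstep (l - 2)) _ (fun l => @bstep_inj (l - 2))).
move/bstep_inj/bstep_inj.
exact: (@foldl_inj (fun l => bstepV (l - 2)) _ (fun l => @bstepV_inj (l - 2))).
Qed.

(* induced action on sets of tuples (in particular on G-classes of tuples) *)
Definition pperm (i j : nat) : {perm {set tup}} :=
  perm (imset_inj (@pure_tup_inj i j)).

(* the pure braid group B_m, as the permutation group it generates *)
Definition Bgrp : {set {perm {set tup}}} :=
  <<[set pperm (nat_of_ord p.1).+1 (nat_of_ord p.2).+1 | p : 'I_m * 'I_m & (p.1 < p.2)%N]>>.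

Variable G : {group gT}.

Definition cls (t : tup) : {set tup} := [set [ffun k => t k ^ g] | g in G].

Definition Sigma (Cs : {ffun 'I_m -> {set gT}}) : {set {set tup}} :=
  [set cls t | t in [set t : tup | [forall k, t k \in Cs k]
                    && (<<[set t k | k : 'I_m]>> == G :> {set gT})
                    && (\prod_(k < m) t k == 1)]].

Definition Zorb (t : tup) : {set {set tup}} := orbit 'P Bgrp (cls t).

End Braid.

Definition cycle_type (T : finType) (p : {perm T}) (Z : {set T}) : seq nat :=
  sort leq (map (fun A : {set T} => #|A|) (enum [set porbit p x | x in Z])).

Definition ncycles (T : finType) (p : {perm T}) (Z : {set T}) : nat :=
  #|[set porbit p x | x in Z]|.

Definition rhoB (gT : finGroupType) (m : nat) (Z : {set {set {ffun 'I_m -> gT}}}) :=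
  (restr_perm Z @* Bgrp gT m)%G.

Definition genus (gT : finGroupType) (m : nat) (Z : {set {set {ffun 'I_m -> gT}}}) : rat :=
  (1 - #|Z|%:R + ((m.-1)%:R * #|Z|%:R
     - \sum_(2 <= j < m.+1) (ncycles (pperm gT m 1 j) Z)%:R) / 2)%R.

(* Main.v *)
Require Import Defs.
From HB Require Import structures.
From mathcomp Require Import all_boot all_order all_algebra all_fingroup all_solvable.
Import GroupScope.

(** With [w = s1 s2 s1] and [y = s2 s1], G is a quotient of the free product
    PSL_2(Z) = <w, y | w^2 = y^3 = 1>.  Reduced words in [w] and [y] therefore
    decide which pure braid images of nine explicit tuples are conjugate, in the
    same way for every G, and each beta_ij acts on the nine classes by a fixed
    table.  These tables generate ASL_2(3) = F_3^2 : SL_2(3) on the affine plane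
    over F_3, with SL_2(3) = Q_8 : C_3.  This action is 2-transitive, so if two of
    the nine classes coincided, then so would the classes of
    (s1, s2, s1, s1, y) and (s2, s1 s2 s1^-1, s1, s1, y); the conjugator would send s1 both
    to s2 and to s1, making G abelian although its center is trivial. *)

Set Implicit Arguments. Unset Strict Implicit. Unset Printing Implicit Defensive.

(** * Recognition of [Q_8] and of an iterated semidirect product from relations *)

(** The relations present [Q_8], so the subgroup is a quotient of it and its order divides 8. It
    properly contains the cyclic group of order 4 generated by [x], which leaves only order 8. *)
Lemma quaternion8_isog (gT : finGroupType) (x y : gT) :
    x ^+ 4 = 1 -> x ^+ 2 != 1 -> y ^+ 2 = x ^+ 2 -> x ^ y = x^-1 ->
  #|<<[set x; y]>>| = 8 /\ <<[set x; y]>> \isog 'Q_8.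
Proof.
move=> x4 x2 yy xy.
have ox : #[x] = 4.
  have := dvdn_leq (isT : 0 < 4) (eqbRL (order_dvdn x 4) (introT eqP x4)).
  have := order_gt0 x; have : ~~ (#[x] %| 2) by rewrite order_dvdn.
  have : #[x] %| 4 by rewrite order_dvdn x4.
  by case: #[x] => [|[|[|[|[|n]]]]].
(* A power of [x] would centralize [x], so inverting it would force [x ^+ 2 = 1]. *)
have y'x : y \notin <[x]>.
  apply: contra x2 => /cycleP[i yE].
  have := xy; rewrite yE conjgE -expgS expgSr mulKg => xx.
  by apply/eqP; rewrite expgS {2}xx mulgV.
have homK : <<[set x; y]>> \homg 'Q_8.
  rewrite (@Grp_quaternion 3) //; apply/existsP; exists (x, y) => /=.
  by rewrite !xpair_eqE x4 yy xy !eqxx !andbT joing_idl joing_idr.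
have le8 : #|<<[set x; y]>>| %| 8.
  by rewrite -[X in _ %| X](@card_quaternion 3) //; apply: card_homg.
have sxK : <[x]> \subset <<[set x; y]>> by rewrite genS // sub1set !inE eqxx.
have dvd4 := cardSg sxK; rewrite -/#[x] ox in dvd4.
have oK : #|<<[set x; y]>>| = 8.
  have : #|<<[set x; y]>>| != 4.
    apply: contraNneq y'x => oK; have /eqP -> : <[x]> == <<[set x; y]>>.
      by rewrite eqEcard sxK -/#[x] ox oK.
    by rewrite mem_gen // !inE eqxx orbT.
  have := dvdn_leq (isT : 0 < 8) le8.
  by case: #|_| dvd4 le8 => [|[|[|[|[|[|[|[|[|n]]]]]]]]].
by split; rewrite // isogEcard homK (@card_quaternion 3) // oK.
Qed.

(** The factors are [<[a]>], [<[b]>], the quaternion group of [x] and [y], and [<[c]>]. Orders 9 and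
    8 are coprime, which separates the first two layers. Everything else rests on [b ^ c != b]: it
    shows that [c] is nontrivial, that [<[a]>] and [<[b]>] differ, and that [c] lies outside [H]. *)
Lemma triple_decomposition (gT : finGroupType) (a b x y c : gT) :
    a != 1 -> a ^+ 3 = 1 -> commute a b ->
    x ^+ 2 != 1 -> x ^+ 4 = 1 -> y ^+ 2 = x ^+ 2 -> x ^ y = x^-1 ->
    c ^+ 3 = 1 -> a ^ x = b -> b ^ x = a ^+ 2 ->
    a ^ y = a ^+ 2 * b -> b ^ y = a * b -> a ^ c = a -> b ^ c = a ^+ 2 * b ->
    x ^ c = y -> y ^ c = x * y ->
  exists N1 N2 N H K L : {group gT},
    [/\ cyclic N1 /\ #|N1| = 3, cyclic N2 /\ #|N2| = 3, N1 \x N2 = N,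
        K \isog 'Q_8 /\ N ><| K = H &
        (cyclic L /\ #|L| = 3) /\ H ><| L = <<[set a; b; x; y; c]>>].
Proof.
move=> a_n1 a3 cab x2 x4 yy xy c3 ax bx ay b_y ac bc xc yc.
have [oK isoK] := quaternion8_isog x4 x2 yy xy.
set K := <<[set x; y]>> in oK isoK.
have oa : #[a] = 3 by apply: nt_prime_order.
have ob : #[b] = 3 by rewrite -ax orderJ.
have b_neq_bc : b ^ c != b.
  rewrite bc -[X in _ != X]mul1g (inj_eq (mulIg b)).
  by rewrite -order_dvdn oa.
have oc : #[c] = 3.
  by apply: nt_prime_order => //; apply: contraNneq b_neq_bc => ->; rewrite conjg1.
(* Two groups of order 3 that meet nontrivially coincide; then [b] would be a power of [a], hence
   fixed by [c]. *)
have tiab : <[a]> :&: <[b]> = 1.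
  apply: prime_TIg; first by rewrite -/#[a] oa.
  apply: contra b_neq_bc => sab.
  have /eqP eab : <[a]> == <[b]> by rewrite eqEcard sab -/#[a] -/#[b] oa ob.
  have /cycleP[i ->] : b \in <[a]> by rewrite eab cycle_id.
  by rewrite conjXg ac.
have defN : <[a]> \x <[b]> = <[a]> <*> <[b]>.
  apply: dprodEY; rewrite //= !cent_cycle cycle_subG; apply/cent1P.
  by [exact: cab | exact: commute_sym].
have oN : #|<[a]> <*> <[b]>| = 9 by rewrite -(dprod_card defN) -/#[a] -/#[b] oa ob.
have aN : a \in <[a]> <*> <[b]> by rewrite mem_gen // !inE cycle_id.
have bN : b \in <[a]> <*> <[b]> by rewrite mem_gen // !inE cycle_id orbT.
have normN z : a ^ z \in <[a]> <*> <[b]> -> b ^ z \in <[a]> <*> <[b]> ->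
    z \in 'N(<[a]> <*> <[b]>).
  move=> az bz; rewrite inE -genJ gen_subG conjUg -!cycleJ subUset.
  by rewrite !cycle_subG az bz.
have xN : x \in 'N(<[a]> <*> <[b]>) by rewrite normN ?ax ?bx ?groupX.
have yN : y \in 'N(<[a]> <*> <[b]>) by rewrite normN ?ay ?b_y ?groupM ?groupX.
have cN : c \in 'N(<[a]> <*> <[b]>) by rewrite normN ?ac ?bc ?groupM ?groupX.
have sKN : K \subset 'N(<[a]> <*> <[b]>).
  by rewrite gen_subG subUset !sub1set xN yN.
have tiNK : <[a]> <*> <[b]> :&: K = 1 by apply: coprime_TIg; rewrite oN oK.
have defH := sdprodEY sKN tiNK.
have [nsNH _ _ _ _] := sdprod_context defH.
have oH : #|<[a]> <*> <[b]> <*> K| = 72 by rewrite -(sdprod_card defH) oN oK.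
have xK : x \in K by rewrite mem_gen // !inE eqxx.
have yK : y \in K by rewrite mem_gen // !inE eqxx orbT.
have cK : c \in 'N(K).
  rewrite inE -genJ gen_subG conjUg !conjg_set1 xc yc subUset !sub1set.
  by rewrite yK groupM.
have cH : c \in 'N(<[a]> <*> <[b]> <*> K) by rewrite -cycle_subG normsY ?cycle_subG.
have c'H : c \notin <[a]> <*> <[b]> <*> K.
  have hallN : 3.-Hall(<[a]> <*> <[b]> <*> K) (<[a]> <*> <[b]>).
    rewrite /pHall (normal_sub nsNH) -(divgS (normal_sub nsNH)) oH oN.
    by rewrite /pgroup oN.
  (* N is the normal Sylow 3-subgroup of H; inside it c would centralize b. *)
  apply: contra b_neq_bc => Hc; have := mem_normal_Hall hallN nsNH Hc.
  rewrite /p_elt oc => Nc; apply/eqP/conjg_fixP/commgP.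
  have abN : abelian (<[a]> <*> <[b]>).
    by rewrite abelianY !cycle_abelian; have [_ _ ->] := dprodP defN.
  by apply: (centsP abN).
have tiHL : <[a]> <*> <[b]> <*> K :&: <[c]> = 1.
  rewrite setIC; apply: prime_TIg; first by rewrite -/#[c] oc.
  by rewrite cycle_subG.
have sLH : <[c]> \subset 'N(<[a]> <*> <[b]> <*> K) by rewrite cycle_subG.
have defM := sdprodEY sLH tiHL.
exists <[a]>%G, <[b]>%G, (<[a]> <*> <[b]>)%G, (<[a]> <*> <[b]> <*> K)%G.
exists <<[set x; y]>>%G, <[c]>%G.
split; rewrite ?cycle_cyclic //; split=> //.
rewrite defM; apply/eqP; rewrite eqEsubset; apply/andP; split.
  rewrite join_subG cycle_subG join_subG join_subG !cycle_subG -!andbA.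
  by rewrite genS ?subUset ?sub1set ?mem_gen ?inE ?eqxx ?orbT.
have sHM := subsetP (joing_subl (<[a]> <*> <[b]> <*> K) <[c]>).
rewrite gen_subG !subUset !sub1set.
have -> : c \in <[a]> <*> <[b]> <*> K <*> <[c]>.
  by rewrite mem_gen // inE cycle_id orbT.
by rewrite !sHM // mem_gen // inE ?aN ?bN ?xK ?yK ?orbT.
Qed.

(** * Computation with words in Z/2 * Z/3 *)

(* Words in the free product Z/2 * Z/3: [true] is the letter of order 2 and
   [false] the letter of order 3; words are positive, so the inverse of [false]
   is spelled [false; false]. *)
Definition word := seq bool.

(** Left multiplication of a reduced word by one letter; folding it yields the normal form in the
    free product, with no square of [true] and no cube of [false]. *)
Definition push (a : bool) (v : word) : word :=
  match a, v with
  | true, true :: v' => v'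
  | false, false :: false :: v' => v'
  | _, _ => a :: v
  end.

Definition reduce (v : word) : word := foldr push [::] v.

Definition winv (v : word) : word :=
  flatten [seq if a then [:: true] else [:: false; false] | a <- rev v].

Definition wconj (v g : word) : word := reduce (winv g ++ v ++ g).

Definition prefixes (v : word) : seq word := [seq take n v | n <- iota 0 (size v).+1].

(** A sufficient test: the word [v] is expected to reduce from [g u g^-1] with [g] one of its own
    prefixes. *)
Definition conjugate_of (u v : word) : bool :=
  has (fun g => wconj u (winv g) == v) (prefixes v).

Section WordTuples.
Variable m : nat.

Definition wstep (k : nat) (l : seq word) : seq word :=
  if k.+1 < m then
    mkseq (fun i => if i == k then wconj (nth [::] l k.+1) (winv (nth [::] l k))
                    else if i == k.+1 then nth [::] l k else nth [::] l i) m
  else l.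

Definition wstepV (k : nat) (l : seq word) : seq word :=
  if k.+1 < m then
    mkseq (fun i => if i == k then nth [::] l k.+1
                    else if i == k.+1 then wconj (nth [::] l k) (nth [::] l k.+1)
                    else nth [::] l i) m
  else l.

Definition wpure (i j : nat) (l : seq word) : seq word :=
  let ls := iota i.+1 (j - i.+1) in
  let l1 := foldl (fun u k => wstepV (k - 2) u) l ls in
  let l2 := wstep (j - 2) (wstep (j - 2) l1) in
  foldl (fun u k => wstep (k - 2) u) l2 (rev ls).

End WordTuples.

(* Sound but not complete: the candidate conjugators straighten the last entry,
   a conjugate of [false], and then run through the centralizer of [false]. *)
Definition same_class (l l' : seq word) : bool :=
  has (fun g => [seq wconj v g | v <- l] == l')
    [seq g ++ nseq n false | g <- prefixes (last [::] l), n <- iota 0 3].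

(** A sufficient test that looks only at entries, their inverses and products of two of these. *)
Definition generates (l : seq word) (v : word) : bool :=
  let l1 := l ++ [seq winv u | u <- l] in
  v \in l1 ++ [seq reduce (u ++ u') | u <- l1, u' <- l1].

(** * Evaluation of words in a group satisfying the two relations *)

Section Evaluation.
Variables (gT : finGroupType) (w y : gT).
Hypotheses (w2 : w ^+ 2 = 1) (y3 : y ^+ 3 = 1).

Definition ev (v : word) : gT := \prod_(a <- v) (if a then w else y).

Lemma ev_cat u v : ev (u ++ v) = ev u * ev v.
Proof. exact: big_cat. Qed.

Lemma ev_cons a v : ev (a :: v) = (if a then w else y) * ev v.
Proof. exact: big_cons. Qed.

Lemma ev_nil : ev [::] = 1.
Proof. exact: big_nil. Qed.

Lemma ev_push a v : ev (push a v) = ev (a :: v).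
Proof.
case: a v => [] [|[] [|[] v]] //=; rewrite !ev_cons ?ev_nil !mulgA ?mulg1.
- by rewrite -[w * w]/(w ^+ 2) w2.
- by rewrite -[w * w]/(w ^+ 2) w2 mul1g.
- by rewrite -[w * w]/(w ^+ 2) w2 mul1g.
- by rewrite -[y * y * y]mulgA -[y * (y * y)]/(y ^+ 3) y3 mul1g.
Qed.

Lemma ev_reduce v : ev (reduce v) = ev v.
Proof. by elim: v => //= a v IH; rewrite ev_push !ev_cons IH. Qed.

Lemma ev_winv v : ev (winv v) = (ev v)^-1.
Proof.
elim: v => [|a v IH]; first by rewrite /winv /= ev_nil invg1.
rewrite /winv rev_cons map_rcons -cats1 flatten_cat ev_cat -/(winv v) IH.
rewrite ev_cons invMg /= cats0; congr (_ * _).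
case: a; rewrite !ev_cons ev_nil mulg1; apply/esym/eqP.
  by rewrite eq_invg_mul -[w * w]/(w ^+ 2) w2.
by rewrite eq_invg_mul -[y * (y * y)]/(y ^+ 3) y3.
Qed.

Lemma ev_wconj u g : ev (wconj u g) = ev u ^ ev g.
Proof. by rewrite ev_reduce !ev_cat ev_winv conjgE. Qed.

Lemma mem_ev (G : {group gT}) v : w \in G -> y \in G -> ev v \in G.
Proof. by move=> wG yG; apply: group_prod => -[]. Qed.

Lemma conjugate_ofP (G : {group gT}) u v :
  w \in G -> y \in G -> conjugate_of u v -> ev v \in ev u ^: G.
Proof.
move=> wG yG /hasP[g _ /eqP <-].
by rewrite ev_wconj ev_winv memJ_class ?groupV ?mem_ev.
Qed.

Lemma generatesP (G : {group gT}) l v :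
  (forall u, u \in l -> ev u \in G) -> generates l v -> ev v \in G.
Proof.
move=> lG; rewrite /generates; set l1 := l ++ _.
have l1G u : u \in l1 -> ev u \in G.
  by rewrite mem_cat => /orP[/lG //|/mapP[u' /lG uG ->]]; rewrite ev_winv groupV.
rewrite mem_cat => /orP[/l1G //|/allpairsP[[u u'] /= [/l1G uG /l1G u'G ->]]].
by rewrite ev_reduce ev_cat groupM.
Qed.

Section EvTuples.
Variable m : nat.

Definition tup_of (l : seq word) : {ffun 'I_m -> gT} :=
  [ffun i : 'I_m => ev (nth [::] l i)].

Lemma at_tup_of l k : k < m -> at_ (tup_of l) k = ev (nth [::] l k).
Proof. by move=> km; rewrite (at_E (tup_of l) (Ordinal km)) ffunE. Qed.

Lemma bstep_tup_of k l : bstep k (tup_of l) = tup_of (wstep m k l).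
Proof.
rewrite /bstep /wstep; case: ifP => // km; have km' := ltnW km.
apply/ffunP=> i; rewrite !ffunE nth_mkseq // !at_tup_of //.
by do 2?case: ifP => // _; rewrite ev_wconj ev_winv conjgE invgK mulgA.
Qed.

Lemma bstepV_tup_of k l : bstepV k (tup_of l) = tup_of (wstepV m k l).
Proof.
rewrite /bstepV /wstepV; case: ifP => // km; have km' := ltnW km.
apply/ffunP=> i; rewrite !ffunE nth_mkseq // !at_tup_of //.
by do 2?case: ifP => // _; rewrite ev_wconj conjgE mulgA.
Qed.

(** Hurwitz moves use only conjugation and permutation of entries, so they can be carried out on
    words before evaluation. *)
Lemma pure_tup_of i j l : pure_tup i j (tup_of l) = tup_of (wpure m i j l).
Proof.
rewrite /pure_tup /wpure; set ls := iota _ _.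
rewrite (_ : foldl _ (tup_of l) ls
  = tup_of (foldl (fun u k => wstepV m (k - 2) u) l ls)); last first.
  by elim: ls l => //= k ls IH l; rewrite bstepV_tup_of IH.
rewrite !bstep_tup_of; move: (wstep _ _ (wstep _ _ _)) => {}l.
by elim: (rev ls) l => //= k {}ls IH l; rewrite bstep_tup_of IH.
Qed.

End EvTuples.
End Evaluation.

(** * The braid action on classes of tuples *)

Section BraidClasses.
Variables (gT : finGroupType) (m : nat) (G : {group gT}).
Implicit Type t : {ffun 'I_m -> gT}.

Definition tconj t (g : gT) : {ffun 'I_m -> gT} := [ffun k => t k ^ g].

Lemma at_tconj t g k : at_ (tconj t g) k = at_ t k ^ g.
Proof. by rewrite /at_; case: insub => [i|]; rewrite ?ffunE ?conj1g. Qed.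

Lemma bstep_tconj k t g : bstep k (tconj t g) = tconj (bstep k t) g.
Proof.
rewrite /bstep; case: ifP => // km; apply/ffunP=> i; rewrite !ffunE !at_tconj.
by do 2?case: ifP => // _; rewrite !conjMg conjVg.
Qed.

Lemma bstepV_tconj k t g : bstepV k (tconj t g) = tconj (bstepV k t) g.
Proof.
rewrite /bstepV; case: ifP => // km; apply/ffunP=> i; rewrite !ffunE !at_tconj.
by do 2?case: ifP => // _; rewrite !conjMg conjVg.
Qed.

Lemma pure_tup_tconj i j t g : pure_tup i j (tconj t g) = tconj (pure_tup i j t) g.
Proof.
rewrite /pure_tup; set ls := iota _ _.
rewrite (_ : foldl _ (tconj t g) ls
  = tconj (foldl (fun u k => bstepV (k - 2) u) t ls) g); last first.
  by elim: ls t => //= k ls IH t; rewrite bstepV_tconj IH.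
rewrite !bstep_tconj; move: (bstep _ (bstep _ _)) => {}t.
by elim: (rev ls) t => //= k {}ls IH t; rewrite bstep_tconj IH.
Qed.

(** Braiding commutes with simultaneous conjugation, so the action on sets of tuples sends classes
    to classes and can be computed on one representative. *)
Lemma pperm_cls i j t : pperm gT m i j (cls G t) = cls G (pure_tup i j t).
Proof.
rewrite permE /cls -imset_comp; apply: eq_imset => g /=.
exact: pure_tup_tconj.
Qed.

Lemma cls_tconj t g : g \in G -> cls G (tconj t g) = cls G t.
Proof.
have sub u h : h \in G -> cls G (tconj u h) \subset cls G u.
  move=> hG; apply/subsetP=> _ /imsetP[k kG ->]; apply/imsetP.
  by exists (h * k); [rewrite groupM | apply/ffunP=> i; rewrite !ffunE conjgM].
move=> gG; apply/eqP; rewrite eqEsubset sub //.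
have {1}-> : t = tconj (tconj t g) g^-1.
  by apply/ffunP=> i; rewrite !ffunE conjgK.
by rewrite sub ?groupV.
Qed.

End BraidClasses.

Lemma same_classP (gT : finGroupType) (G : {group gT}) (w y : gT) m l l' :
    w ^+ 2 = 1 -> y ^+ 3 = 1 -> w \in G -> y \in G -> same_class l l' ->
  cls G (tup_of w y m l) = cls G (tup_of w y m l').
Proof.
move=> w2 y3 wG yG /hasP[g _ /eqP <-].
rewrite -(cls_tconj _ (mem_ev g wG yG)); congr cls; apply/ffunP=> i; rewrite !ffunE.
have [il|li] := ltnP i (size l); first by rewrite (nth_map [::]) // ev_wconj.
(* Past the end of the list both tuples take the value 1, which conjugation fixes. *)
by rewrite !nth_default ?size_map // ev_nil conj1g.
Qed.

(** * Cycle types read off from explicit cycles *)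

Lemma porbit_fcycle (T : finType) (p : {perm T}) (c : seq T) x :
  fcycle p c -> x \in c -> porbit p x =i c.
Proof.
move=> pc xc z; apply/porbitP/idP => [[i ->]|zc].
  rewrite permX; elim: i => //= i IH.
  by rewrite (eqP (next_cycle pc IH)) mem_next.
exists (findex p x z); rewrite permX iter_findex //.
by rewrite -(fconnect_cycle pc xc) in zc.
Qed.

Section CycleDecomposition.
Variables (T : finType) (p : {perm T}) (Z : {set T}) (cs : seq (seq T)).
Hypotheses (cs_cycle : all (fcycle p) cs) (cs_uniq : uniq (flatten cs)).
Hypotheses (cs_nil : [::] \notin cs) (csZ : flatten cs =i Z).

Lemma porbits_fcycles :
  perm_eq (enum [set porbit p x | x in Z]) [seq [set x in c] | c : seq T <- cs].
Proof.
(* Since the concatenation has no repetition, two lists sharing a point are equal. *)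
have cs_disj c c' x : c \in cs -> c' \in cs -> x \in c -> x \in c' -> c = c'.
  move: cs_uniq; elim: (cs) => //= d s IH; rewrite cat_uniq !inE.
  case/and3P=> _ /hasPn ds us /orP[/eqP->|cs'] /orP[/eqP->|cs''] //.
  - by move=> xd xc'; have /negP[] // : x \notin d by apply: ds; apply/flattenP; exists c'.
  - by move=> xc xd; have /negP[] // : x \notin d by apply: ds; apply/flattenP; exists c.
  by apply: IH.
have cs_orb c x : c \in cs -> x \in c -> porbit p x = [set x in c].
  move=> ccs xc; apply/setP=> z.
  by rewrite inE (porbit_fcycle (allP cs_cycle c ccs) xc).
apply: uniq_perm; first exact: enum_uniq.
  rewrite map_inj_in_uniq => [|c c' ccs c'cs /setP eqc].
    (* A repeated nonempty list would repeat its points in the concatenation; only empty lists could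
       escape this, and they are excluded. *)
    move: cs_uniq cs_nil; elim: (cs) => //= d s IH; rewrite cat_uniq inE negb_or.
    case/and3P=> _ /hasPn ds us /andP[d_n0 s_n0]; rewrite IH // andbT.
    case: d d_n0 ds => // x d _ ds; apply/negP => dxs.
    have /negP[] : x \notin x :: d.
      by apply: ds; apply/flattenP; exists (x :: d); rewrite ?mem_head.
    exact: mem_head.
  case: c ccs eqc => [|x c] ccs eqc; first by case/negP: cs_nil.
  by apply: cs_disj ccs c'cs (mem_head x c) _; have := eqc x; rewrite !inE eqxx.
move=> A; rewrite mem_enum; apply/imsetP/mapP => [[x]|[c ccs ->]].
  by rewrite -csZ => /flattenP[c ccs xc] ->; exists c; rewrite ?(cs_orb c).
case: c ccs => [|x c] ccs; first by case/negP: cs_nil.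
exists x; last by rewrite (cs_orb (x :: c)) ?mem_head.
by rewrite -csZ; apply/flattenP; exists (x :: c); rewrite ?mem_head.
Qed.

Lemma cycle_type_fcycles : cycle_type p Z = sort leq [seq size c | c <- cs].
Proof.
apply/perm_sortP; [exact: leq_total | exact: leq_trans | exact: anti_leq | ].
apply: perm_trans (perm_map _ porbits_fcycles) _; rewrite -map_comp.
suff <- : [seq #|[set x in c]| | c : seq T <- cs] = map size cs by [].
apply/eq_in_map => c ccs; rewrite cardsE; apply/card_uniqP.
move: cs_uniq; elim: (cs) ccs => //= d s IH; rewrite inE cat_uniq.
by case/orP=> [/eqP-> /and3P[]|/IH cu /and3P[_ _ /cu]].
Qed.

Lemma ncycles_fcycles : ncycles p Z = size cs.
Proof. by rewrite /ncycles cardE (perm_size porbits_fcycles) size_map. Qed.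

End CycleDecomposition.

(** * Permutations described by tables on indices *)

Section Tables.
Variables (T : finType) (n : nat) (f : nat -> T).
Hypothesis f_inj : {in gtn n &, injective f}.
Local Notation Z := [set f (val k) | k : 'I_n].

Definition table_of (p : {perm T}) (s : seq nat) : Prop :=
  forall k, k < n -> nth 0 s k < n /\ p (f k) = f (nth 0 s k).

(** Each cycle is recorded once, through its least element. Walking [n] steps covers it, and
    [undup], which keeps last occurrences, leaves a cyclic rotation of it. *)
Definition table_cycles (s : seq nat) : seq (seq nat) :=
  let orb k := undup (traject (nth 0 s) k n) in
  [seq orb k | k <- iota 0 n & all (leq k) (orb k)].

(** Checks the computed lists afterwards, so that no general correctness proof of [table_cycles] is
    required. *)
Definition cycles_ok (s : seq nat) : bool :=
  let cs := table_cycles s in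
  [&& all (fcycle (nth 0 s)) cs, perm_eq (flatten cs) (iota 0 n) & [::] \notin cs].

Lemma mem_range (k : nat) : k < n -> f k \in Z.
Proof. by move=> kn; apply/imsetP; exists (Ordinal kn). Qed.

Lemma table_cycle_type p s : table_of p s -> cycles_ok s ->
  cycle_type p Z = sort leq [seq size c | c <- table_cycles s] /\
  ncycles p Z = size (table_cycles s).
Proof.
move=> ps /and3P[cyc eq_cs cs_n0]; set cs := table_cycles s in cyc eq_cs cs_n0 *.
have cs_n c k : c \in cs -> k \in c -> k < n.
  move=> ccs kc; have : k \in flatten cs by apply/flattenP; exists c.
  by rewrite (perm_mem eq_cs) mem_iota.
pose cs' := [seq map f c | c <- cs].
have flat' : flatten cs' = map f (flatten cs) by rewrite map_flatten.
have cyc' : all (fcycle p) cs'.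
  apply/allP=> _ /mapP[c ccs ->].
  apply: homo_cycle_in (_ : all (gtn n) c) (allP cyc c ccs) => [k l kn _ /eqP <-|].
    by apply/eqP; case: (ps k kn).
  by apply/allP=> k; apply: cs_n.
have uniq' : uniq (flatten cs').
  rewrite flat' map_inj_in_uniq ?(perm_uniq eq_cs) ?iota_uniq // => k l.
  by rewrite !(perm_mem eq_cs) !mem_iota /= => kn ln /f_inj; apply.
have nil' : [::] \notin cs'.
  by apply: contra cs_n0 => /mapP[[|? ?]].
have Z' : flatten cs' =i Z.
  move=> z; rewrite flat'; apply/mapP/imsetP=> [[k]|[k _ ->]].
    by rewrite (perm_mem eq_cs) mem_iota => kn ->; exists (Ordinal kn).
  by exists (val k); rewrite ?(perm_mem eq_cs) ?mem_iota /=.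
rewrite (cycle_type_fcycles cyc' uniq' nil' Z') (ncycles_fcycles cyc' uniq' nil' Z').
split; last exact: size_map.
by congr (sort leq _); rewrite -map_comp; apply: eq_map => c; apply: size_map.
Qed.

Lemma card_range : #|Z| = n.
Proof.
rewrite card_imset ?card_ord // => k l fkl.
by apply/val_inj/f_inj => //; apply: ltn_ord.
Qed.

Lemma table_perm_inj p q s : perm_on Z p -> perm_on Z q ->
  table_of p s -> table_of q s -> p = q.
Proof.
move=> Zp Zq ps qs; apply/permP=> z; have [/imsetP[k _ ->]|Z'z] := boolP (z \in Z).
  by rewrite (ps _ (ltn_ord k)).2 (qs _ (ltn_ord k)).2.
by rewrite !(out_perm _ Z'z).
Qed.

Section Words.
Variables (I : eqType) (dom : seq I) (P : I -> {perm T}) (tab : I -> seq nat).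
Hypothesis P_tab : {in dom, forall i, table_of (P i) (tab i)}.

Definition word_move (u : seq I) (k : nat) : nat :=
  foldl (fun k i => nth 0 (tab i) k) k u.
Definition word_table (u : seq I) : seq nat := mkseq (word_move u) n.
Definition word_perm (u : seq I) : {perm T} := \prod_(i <- u) P i.

Lemma word_perm_cat u v : word_perm (u ++ v) = word_perm u * word_perm v.
Proof. exact: big_cat. Qed.

Lemma word_perm_on u : {in dom, forall i, perm_on Z (P i)} ->
  {subset u <= dom} -> perm_on Z (word_perm u).
Proof.
move=> P_on u_dom; rewrite /word_perm big_seq.
apply: (big_ind (fun p => perm_on Z p)); first exact: perm_on1.
  by move=> p q; apply: perm_onM.
by move=> i /u_dom/P_on.
Qed.

Lemma word_permE u k : {subset u <= dom} -> k < n ->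
  word_move u k < n /\ word_perm u (f k) = f (word_move u k).
Proof.
rewrite /word_perm; elim: u k => [|i u IH] k u_dom kn; first by rewrite big_nil perm1.
have [ikn fik] := P_tab (u_dom i (mem_head i u)) kn.
rewrite big_cons permM fik; apply: IH => // j ju.
by apply: u_dom; rewrite inE ju orbT.
Qed.

Lemma word_table_of u : {subset u <= dom} -> table_of (word_perm u) (word_table u).
Proof. by move=> u_dom k kn; rewrite nth_mkseq //; apply: word_permE. Qed.

(** Both products fix everything outside [Z], and on [Z] injectivity of [f] makes them determined by
    their tables. Relations between permutations thus become computations on lists of numbers. *)
Lemma word_perm_eq u v : {in dom, forall i, perm_on Z (P i)} ->
    {subset u <= dom} -> {subset v <= dom} ->
  (word_perm u == word_perm v) = (word_table u == word_table v).
Proof.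
move=> P_on u_dom v_dom; apply/eqP/eqP => [eq_uv|eq_uv].
  apply: (@eq_from_nth _ 0); rewrite !size_mkseq // => k kn; rewrite !nth_mkseq //.
  have [un fu] := word_permE u_dom kn; have [vn fv] := word_permE v_dom kn.
  by apply: f_inj => //; rewrite -fu -fv eq_uv.
apply: (@table_perm_inj _ _ (word_table u)); rewrite ?word_perm_on //.
  exact: word_table_of.
by rewrite eq_uv; apply: word_table_of.
Qed.

End Words.

End Tables.

(** * Explicit data for the nine classes *)

(* In terms of [w = s1 s2 s1] and [y = s2 s1] one has [s1 = w y^-1] and
   [s2 = y^-1 w]; [s3] and [s4] are [s1 s2 s1^-1] and [s1^-1 s2 s1]. *)
Definition orbit_reps : seq (seq word) :=
  let y0 := [:: false] in
  let s1 := [:: true; false; false] in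
  let s2 := [:: false; false; true] in
  let s3 := [:: true; false; true; false; true] in
  let s4 := [:: false; true; false] in
  [:: [:: s1; s2; s1; s1; y0];
      [:: s2; s3; s1; s1; y0];
      [:: s4; s2; s2; s1; y0];
      [:: s1; s4; s2; s1; y0];
      [:: s2; s2; s1; s2; y0];
      [:: s2; s2; s2; s3; y0];
      [:: s2; s1; s2; s1; y0];
      [:: s3; s1; s1; s1; y0];
      [:: s2; s2; s3; s1; y0]].

Definition pure_pairs : seq (nat * nat) :=
  [seq p <- [seq (i, j) | i <- iota 1 5, j <- iota 1 5] | p.1 < p.2].

(** One row per pair, in the order of [pure_pairs]; entry [k] is the index of the image of class
    [k]. The final empty row serves pairs outside the list. *)
Definition braid_table (p : nat * nat) : seq nat :=
  nth [::] [:: [:: 1; 7; 6; 2; 4; 5; 3; 0; 8];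
      [:: 2; 1; 8; 3; 6; 5; 7; 4; 0];
      [:: 3; 1; 7; 4; 0; 2; 6; 5; 8];
      [:: 1; 0; 5; 8; 6; 2; 4; 7; 3];
      [:: 4; 6; 2; 0; 3; 5; 8; 7; 1];
      [:: 5; 2; 4; 3; 1; 6; 0; 7; 8];
      [:: 0; 7; 8; 4; 3; 6; 5; 1; 2];
      [:: 0; 1; 3; 6; 5; 8; 2; 7; 4];
      [:: 3; 2; 1; 0; 4; 8; 7; 6; 5];
      [:: 6; 3; 7; 1; 8; 5; 0; 2; 4];
      [::]]%N (index p pure_pairs).

(* On the nine points, identified with the affine plane over F_3, [wa] and [wb]
   act as independent translations, [wx] and [wy] generate the Sylow 2-subgroup
   Q_8 of SL_2(3) fixing point 8, and [wc] is an element of order 3 in SL_2(3). *)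
Definition wa : seq (nat * nat) := [:: (1, 5); (2, 5)]%N.
Definition wb : seq (nat * nat) := [:: (1, 5); (3, 5)]%N.
Definition wx : seq (nat * nat) := [:: (1, 2); (1, 2); (1, 4)]%N.
Definition wy : seq (nat * nat) := [:: (1, 2); (1, 2); (2, 4)]%N.
Definition wc : seq (nat * nat) := [:: (1, 2)]%N.

(** Factorizations of the ten pure generators in the order of [pure_pairs]. For instance each
    beta_i5 is a translation times the central involution, the square of [wx]. *)
Definition pure_factors : seq (seq (seq (nat * nat))) :=
  [:: [:: wc]; [:: wb; wy; wc]; [:: wx; wy; wc]; [:: wa; wb; wx; wx];
      [:: wa; wa; wb; wx; wy; wc]; [:: wx; wc]; [:: wb; wx; wx];
      [:: wa; wc]; [:: wa; wx; wx]; [:: wa; wa; wx; wx]].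

Definition translations : seq (seq (nat * nat)) :=
  [seq flatten (nseq i wa) ++ flatten (nseq j wb) | i <- iota 0 3, j <- iota 0 3].
(** Every element of [Q_8] is [x^i y^j] with [i < 4] and [j < 2]. Together with the nine
    translations this gives 72 words, a sharply 2-transitive set on the nine points. *)
Definition quaternions : seq (seq (nat * nat)) :=
  [seq flatten (nseq i wx) ++ flatten (nseq j wy) | i <- iota 0 4, j <- iota 0 2].

(** * The orbit, its cycle types and its genus *)

Section Orbit.
Variables (gT : finGroupType) (G : {group gT}) (w y : gT).
Hypotheses (w2 : w ^+ 2 = 1) (y3 : y ^+ 3 = 1).
Hypotheses (defG : G :=: <<[set w; y]>>) (trivZ : 'Z(G) = 1) (ntG : G :!=: 1).

Definition rep (k : nat) : {ffun 'I_5 -> gT} := tup_of w y 5 (nth [::] orbit_reps k).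
Definition rep_cls (k : nat) : {set {ffun 'I_5 -> gT}} := cls G (rep k).
Local Notation Z := [set rep_cls (val k) | k : 'I_9].
Local Notation beta p := (pperm gT 5 p.1 p.2).

Lemma w_in : w \in G. Proof. by rewrite defG mem_gen // !inE eqxx. Qed.
Lemma y_in : y \in G. Proof. by rewrite defG mem_gen // !inE eqxx orbT. Qed.

(** The 90 comparisons are made between reduced words, before evaluation, and therefore hold in
    every quotient of the free product. *)
Lemma beta_table :
  {in pure_pairs, forall p, table_of 9 rep_cls (beta p) (braid_table p)}.
Proof.
move=> p pP k k9.
have /allP/(_ p pP)/allP/(_ k) : all (fun p => all (fun k =>
    (nth 0 (braid_table p) k < 9) && same_class (wpure 5 p.1 p.2 (nth [::] orbit_reps k))
      (nth [::] orbit_reps (nth 0 (braid_table p) k))) (iota 0 9)) pure_pairs.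
  by vm_compute.
rewrite mem_iota => /(_ k9)/andP[-> same]; split=> //.
rewrite /rep_cls pperm_cls /rep pure_tup_of //.
exact: same_classP w2 y3 w_in y_in same.
Qed.

Lemma rep_cls_01 : rep_cls 0 != rep_cls 1.
Proof.
apply/eqP=> eq01.
have /imsetP[g gG /ffunP eq_g] : rep 1 \in cls G (rep 0).
  rewrite -[cls _ _]/(rep_cls 0) eq01; apply/imsetP; exists 1 => //.
  by apply/ffunP=> i; rewrite [RHS]ffunE conjg1.
(* The conjugator takes s1 to s2 in the first entry and s1 to s1 in the third, so s1 = s2. *)
have s12 : w * y ^+ 2 = y ^+ 2 * w.
  have := eq_g (inord 0); have := eq_g (inord 2); rewrite !ffunE !inordK //=.
  by rewrite !ev_cons ev_nil !mulg1 !mulgA => <- <-.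
have cwy : commute w y.
  (* As [y] is a power of [y ^+ 2], it too commutes with [w]. *)
  have y4 : y = y ^+ 2 ^+ 2 by rewrite -expgM (expgD y 3 1) y3 mul1g.
  by rewrite y4; apply: commuteX.
case/eqP: ntG; rewrite -trivZ; apply/esym/center_idP.
by rewrite defG abelian_gen; apply/centsP=> u /set2P[]-> v /set2P[]-> //.
Qed.

(** The tables give images of classes without knowing them to be distinct. A coincidence of classes
    [k] and [l] is transported by a braid word to one of classes 0 and 1, which is excluded. *)
Lemma rep_cls_inj : {in gtn 9 &, injective rep_cls}.
Proof.
move=> k l k9 l9 eq_kl; apply/eqP; apply: contraR rep_cls_01 => neq_kl.
pose words := [seq u ++ v | u <- translations, v <- quaternions].
have move_eq u : {subset u <= pure_pairs} ->
    rep_cls (word_move braid_table u k) = rep_cls (word_move braid_table u l).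
  move=> u_dom; have [_ <-] := word_permE beta_table u_dom k9.
  by have [_ <-] := word_permE beta_table u_dom l9; rewrite eq_kl.
(* 2-transitivity: some word takes the ordered pair [(k, l)] to [(0, 1)]. *)
have /allP/(_ k)  : all (fun k => all (fun l => (k != l) ==> has (fun u =>
    (word_move braid_table u k == 0) && (word_move braid_table u l == 1%N)) words)
    (iota 0 9)) (iota 0 9) by vm_compute.
rewrite mem_iota => /(_ k9)/allP/(_ l); rewrite mem_iota => /(_ l9).
rewrite neq_kl => /hasP[u u_in /andP[/eqP uk /eqP ul]].
have /allP/(_ u u_in)/allP/move_eq : all (all (mem pure_pairs)) words by vm_compute.
by rewrite uk ul => ->.
Qed.

Lemma pure_pair i j : 1 <= i -> i < j -> j <= 5 -> (i, j) \in pure_pairs.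
Proof.
move=> i1 ij j5; rewrite mem_filter ij; apply/allpairsP; exists (i, j).
by rewrite !mem_iota !add1n !ltnS i1 j5 (leq_trans i1 (ltnW ij)) (leq_trans (ltnW ij)).
Qed.

Lemma mem_beta p : p \in pure_pairs -> beta p \in [set q in [seq beta p | p <- pure_pairs]].
Proof. by move=> pP; rewrite inE (map_f (fun p => beta p)). Qed.

Lemma Bgrp_gen : Bgrp gT 5 = <<[set q in [seq beta p | p <- pure_pairs]]>>.
Proof.
congr <<_>>; apply/setP=> q; rewrite inE; apply/imsetP/mapP=> [[[i j] /=]|[[i j]]].
  by rewrite inE => ij ->; exists (i.+1, j.+1); rewrite // pure_pair.
rewrite mem_filter => /andP[ij /allpairsP[[i' j'] [i_in j_in [? ?]]]] ->.
subst i' j'; move: i_in j_in; rewrite !mem_iota => /andP[/= i1 i5] /andP[/= j1 j5].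
case: i j ij i1 i5 j1 j5 => // i [] // j ij _ i5 _ j5.
by exists (Ordinal (i5 : i < 5), Ordinal (j5 : j < 5)); rewrite ?inE.
Qed.

Lemma Bgrp_astabs : Bgrp gT 5 \subset 'N(Z | 'P).
Proof.
rewrite Bgrp_gen gen_subG; apply/subsetP=> q; rewrite inE => /mapP[p pP ->].
rewrite inE; apply/andP; split; first exact: in_setT.
rewrite inE; apply/subsetP=> _ /imsetP[k _ ->]; rewrite inE /= apermE.
by have [kn ->] := beta_table pP (ltn_ord k); apply: mem_range.
Qed.

Lemma Zorb_rep : Zorb G (rep 0) = Z.
Proof.
apply/eqP; rewrite eqEsubset; apply/andP; split.
  have := Bgrp_astabs; rewrite /Zorb Bgrp_gen => /acts_sub_orbit->.
  exact: mem_range.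
apply/subsetP=> _ /imsetP[k _ ->].
(* The translations alone already carry class 0 to all nine classes. *)
have /allP/(_ (val k)) : all (fun k => has (fun u =>
    word_move braid_table u 0 == k) translations) (iota 0 9) by vm_compute.
rewrite mem_iota => /(_ (ltn_ord k))/hasP[u u_in /eqP <-].
have u_dom : {subset u <= pure_pairs}.
  apply/allP; apply/allP: u u_in.
  by have : all (all (mem pure_pairs)) translations by vm_compute.
have [_ <-] := word_permE beta_table u_dom (isT : 0 < 9).
apply: mem_orbit; rewrite Bgrp_gen /word_perm big_seq; apply: group_prod => p pu.
by rewrite mem_gen // mem_beta // u_dom.
Qed.

Lemma card_Z : #|Z| = 9.
Proof. exact: card_range rep_cls_inj. Qed.

Lemma rep_Sigma C D : C = (w * y ^+ 2) ^: G -> D = y ^: G ->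
  Z \subset Sigma G [ffun k : 'I_5 => nth set0 [:: C; C; C; C; D] k].
Proof.
move=> defC defD; apply/subsetP=> _ /imsetP[k _ ->]; apply: imset_f; rewrite inE.
(* All conditions for membership are certified on words: conjugacy of each entry, recovery of [w]
   and [y] from the entries, and product 1. *)
pose ok l := [&& size l == 5,
  all (fun i => conjugate_of (if i < 4 then [:: true; false; false] else [:: false])
                  (nth [::] l i)) (iota 0 5),
  generates l [:: true] && generates l [:: false]
  & reduce (flatten l) == [::]].
have /allP/(_ (nth [::] orbit_reps k))/(_ (mem_nth _ _)) : all ok orbit_reps by vm_compute.
rewrite /rep; set l := nth _ _ _ => /(_ (ltn_ord k))/and4P[/eqP sz_l conj_l gen_l prod_l].
have ev_l : ev w y (flatten l) = 1.
  by rewrite -(ev_reduce w2 y3) (eqP prod_l) ev_nil.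
have s1E : ev w y [:: true; false; false] = w * y ^+ 2.
  by rewrite !ev_cons ev_nil !mulg1.
have entry_class (i : 'I_5) : tup_of w y 5 l i \in (if i < 4 then C else D).
  have := allP conj_l i; rewrite mem_iota ffunE => /(_ (ltn_ord i)).
  move/(conjugate_ofP w2 y3 w_in y_in).
  by rewrite defC defD; case: ifP => _; rewrite ?s1E // !ev_cons ev_nil !mulg1.
apply/andP; split; first (apply/andP; split).
- apply/forallP=> i; have := entry_class i; rewrite [in X in _ -> X]ffunE.
  by case: i => [[|[|[|[|[|i]]]]] i5] //=; rewrite ?ffunE.
- rewrite eqEsubset gen_subG; apply/andP; split.
    by apply/subsetP=> _ /imsetP[i _ ->]; rewrite ffunE mem_ev ?w_in ?y_in.
  have lG u : u \in l -> ev w y u \in <<[set tup_of w y 5 l i | i : 'I_5]>>.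
    move=> ul; have ui : index u l < 5 by rewrite -sz_l index_mem.
    apply/mem_gen/imsetP; exists (Ordinal ui) => //.
    by rewrite ffunE nth_index.
  have /andP[/(generatesP w2 y3 lG) gw /(generatesP w2 y3 lG) gy] := gen_l.
  rewrite defG gen_subG subUset !sub1set.
  by move: gw gy; rewrite !ev_cons ev_nil !mulg1 => -> ->.
apply/eqP; rewrite -[RHS]ev_l; move: sz_l; rewrite !big_ord_recl big_ord0 !ffunE.
by case: (l) => [|? [|? [|? [|? [|? [|? ?]]]]]] //= _; rewrite cats0 !ev_cat mulg1.
Qed.

Lemma beta_cycle_type p s : p \in pure_pairs -> cycles_ok 9 (braid_table p) ->
    sort leq [seq size c | c <- table_cycles 9 (braid_table p)] = s ->
  cycle_type (beta p) Z = s /\ ncycles (beta p) Z = size s.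
Proof.
move=> pP okp <-; have [-> ->] := table_cycle_type rep_cls_inj (beta_table pP) okp.
by rewrite size_sort size_map.
Qed.

Lemma beta_cycle_type3 i j : 1 <= i -> i < j -> j <= 4 ->
  cycle_type (beta (i, j)) Z = [:: 1; 1; 1; 3; 3]%N /\ ncycles (beta (i, j)) Z = 5.
Proof.
move=> i1 ij j4; have ijP := pure_pair i1 ij (leqW j4).
have /allP/(_ _ ijP)/implyP/(_ j4)/andP[ok_ij /eqP ct] :
  all (fun p => (p.2 <= 4) ==> (cycles_ok 9 (braid_table p) &&
    (sort leq [seq size c | c <- table_cycles 9 (braid_table p)]
      == [:: 1; 1; 1; 3; 3]%N))) pure_pairs by vm_compute.
exact: beta_cycle_type ijP ok_ij ct.
Qed.

Lemma beta_cycle_type2 i : 1 <= i -> i < 5 ->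
  cycle_type (beta (i, 5)) Z = [:: 1; 2; 2; 2; 2]%N /\ ncycles (beta (i, 5)) Z = 5.
Proof.
move=> i1 i5; have iP := pure_pair i1 i5 (leqnn 5).
have /allP/(_ _ iP)/implyP/(_ (eqxx 5))/andP[ok_i /eqP ct] :
  all (fun p => (p.2 == 5) ==> (cycles_ok 9 (braid_table p) &&
    (sort leq [seq size c | c <- table_cycles 9 (braid_table p)]
      == [:: 1; 2; 2; 2; 2]%N))) pure_pairs by vm_compute.
exact: beta_cycle_type iP ok_i ct.
Qed.

(** All four beta_1j have five cycles, so the genus is 1 - 9 + (4 * 9 - 4 * 5) / 2 = 0. *)
Lemma genus_Z : genus Z = 0%R.
Proof.
rewrite /genus card_Z big_ltn // big_ltn // big_ltn // big_ltn // big_geq //.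
have ct j (j1 : 1 < j) (j4 : j <= 4) := (beta_cycle_type3 (isT : 0 < 1) j1 j4).
have [_ n5] := beta_cycle_type2 (isT : 0 < 1) (isT : 1 < 5).
have [[_ n2] [_ n3] [_ n4]] := And3 (ct 2 isT isT) (ct 3 isT isT) (ct 4 isT isT).
by rewrite n2 n3 n4 n5.
Qed.

(** * Structure of the permutation group induced on the orbit *)

Local Notation Q p := (restr_perm Z (beta p)).

Lemma Q_on : {in pure_pairs, forall p, perm_on Z (Q p)}.
Proof. by move=> p _; apply: restr_perm_on. Qed.

Lemma beta_Bgrp p : p \in pure_pairs -> beta p \in Bgrp gT 5.
Proof. by move=> pP; rewrite Bgrp_gen mem_gen // mem_beta. Qed.

Lemma Q_table : {in pure_pairs, forall p, table_of 9 rep_cls (Q p) (braid_table p)}.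
Proof.
move=> p pP k k9; have [lt9 eqf] := beta_table pP k9; split=> //.
by rewrite restr_permE ?(subsetP Bgrp_astabs) ?beta_Bgrp ?mem_range.
Qed.

Local Notation P u := (word_perm (fun p => Q p) u).

Lemma Q_word u v : all (mem pure_pairs) (u ++ v) ->
  word_table 9 braid_table u == word_table 9 braid_table v -> P u = P v.
Proof.
rewrite all_cat => /andP[/allP u_dom /allP v_dom] uv; apply/eqP.
by rewrite (word_perm_eq rep_cls_inj Q_table Q_on).
Qed.

Lemma rhoB_gen : rhoB Z = <<[set P wa; P wb; P wx; P wy; P wc]>> :> {set _}.
Proof.
rewrite /= /Bgrp -[generated _]/(Bgrp gT 5) Bgrp_gen morphim_gen; last first.
  by rewrite -gen_subG -Bgrp_gen Bgrp_astabs.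
apply/eqP; rewrite eqEsubset !gen_subG; apply/andP; split.
  apply/subsetP=> _ /morphimP[q _ q_in ->]; move: q_in; rewrite inE => /mapP[p pP ->].
  (* Every pure generator has the same table as one of the listed products of the five chosen
     elements. *)
  have /allP/(_ p pP)/hasP[us us_in /andP[us_dom /eqP us_p]] : all (fun p => has (fun us =>
      all (mem pure_pairs) (p :: flatten us) &&
      (word_table 9 braid_table [:: p] == word_table 9 braid_table (flatten us)))
    pure_factors) pure_pairs by vm_compute.
  rewrite /=; have -> : Q p = P (flatten us).
    by rewrite -(Q_word (u := [:: p])) ?us_p // /word_perm big_seq1.
  have : all (mem [:: wa; wb; wx; wy; wc]) us.
    by apply: (allP _ us us_in); vm_compute.
  clear us_in us_dom us_p; elim: us => [_|u us IH] /=.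
    by rewrite /word_perm big_nil group1.
  case/andP=> u_in /IH usP; rewrite word_perm_cat groupM // mem_gen //.
  by move: u_in; rewrite !inE -!orbA => /or4P[|||/orP[]] /eqP->; rewrite eqxx ?orbT.
have gP u : all (mem pure_pairs) u ->
    P u \in <<restr_perm Z @* [set q in [seq beta p | p <- pure_pairs]]>>.
  move/allP=> u_dom; rewrite /word_perm big_seq; apply: group_prod => p pu.
  have pP := u_dom p pu; rewrite mem_gen //; apply: mem_morphim; last exact: mem_beta.
  by rewrite (subsetP Bgrp_astabs) ?beta_Bgrp.
by rewrite !subUset !sub1set !gP.
Qed.

Lemma Q_word_neq1 u : all (mem pure_pairs) u ->
  word_table 9 braid_table u != iota 0 9 -> P u != 1.
Proof.
move=> /allP u_dom; have <- : P [::] = 1 by exact: big_nil.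
by rewrite (word_perm_eq rep_cls_inj Q_table Q_on).
Qed.

(** A conjugation relation is tested in the form [u x = x v], which avoids inverses of braid
    words. *)
Lemma Q_word_conj u v x : all (mem pure_pairs) ((u ++ x) ++ (x ++ v)) ->
    word_table 9 braid_table (u ++ x) == word_table 9 braid_table (x ++ v) ->
  P u ^ P x = P v.
Proof.
move=> dom eq_uv; apply: (mulgI (P x)); rewrite -conjgC -!word_perm_cat.
exact: Q_word.
Qed.

Lemma rhoB_decomposition :
  exists N1 N2 N H K L : {group {perm {set {ffun 'I_5 -> gT}}}},
    [/\ cyclic N1 /\ #|N1| = 3, cyclic N2 /\ #|N2| = 3, N1 \x N2 = N,
        K \isog 'Q_8 /\ N ><| K = H &
        (cyclic L /\ #|L| = 3) /\ H ><| L = rhoB Z].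
Proof.
have P1 : P [::] = 1 by exact: big_nil.
have PX u k : P u ^+ k = P (flatten (nseq k u)).
  by elim: k => [|k IH]; rewrite ?P1 // expgS IH -word_perm_cat.
have a3 : P wa ^+ 3 = 1 by rewrite PX -P1; apply: Q_word; vm_compute.
have x4 : P wx ^+ 4 = 1 by rewrite PX -P1; apply: Q_word; vm_compute.
rewrite rhoB_gen; apply: triple_decomposition => //.
- by apply: Q_word_neq1; vm_compute.
- by rewrite /commute -!word_perm_cat; apply: Q_word; vm_compute.
- by rewrite PX; apply: Q_word_neq1; vm_compute.
- by rewrite !PX; apply: Q_word; vm_compute.
(* The inverse of [P wx] is rewritten as its cube, which is again a word. *)
- rewrite -[RHS]mul1g -x4 expgSr mulgK PX; apply: Q_word_conj; by vm_compute.
- by rewrite PX -P1; apply: Q_word; vm_compute.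
- by apply: Q_word_conj; vm_compute.
- by rewrite PX; apply: Q_word_conj; vm_compute.
- by rewrite PX -word_perm_cat; apply: Q_word_conj; vm_compute.
- by rewrite -word_perm_cat; apply: Q_word_conj; vm_compute.
- by apply: Q_word_conj; vm_compute.
- by rewrite PX -word_perm_cat; apply: Q_word_conj; vm_compute.
- by apply: Q_word_conj; vm_compute.
- by rewrite -word_perm_cat; apply: Q_word_conj; vm_compute.
Qed.

End Orbit.

(** * Passage from the braid relation to generators of orders 2 and 3 *)

Theorem theorem10 (gT : finGroupType) (G : {group gT}) (s1 s2 : gT) :
  G :!=: 1 -> 'Z(G) = 1 ->
  G :=: <<[set s1; s2]>> ->
  #[s1 * s2 * s1] = 2%N ->
  s1 * s2 * s1 = s2 * s1 * s2 ->
  let C := s1 ^: G in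
  let D := (s2 * s1) ^: G in
  let sigma : {ffun 'I_5 -> gT} := [ffun k : 'I_5 => nth 1 [:: s1; s2; s1; s1; s2 * s1] k] in
  let Z := Zorb G sigma in
  #|Z| = 9%N /\
      Z \subset Sigma G [ffun k : 'I_5 => nth set0 [:: C; C; C; C; D] k] /\
      (forall i j : nat, (1 <= i)%N -> (i < j)%N -> (j <= 4)%N ->
          cycle_type (pperm gT 5 i j) Z = [:: 1; 1; 1; 3; 3]%N) /\
      (forall i : nat, (1 <= i)%N -> (i < 5)%N ->
          cycle_type (pperm gT 5 i 5) Z = [:: 1; 2; 2; 2; 2]%N) /\
      (exists (N1 N2 N H K L : {group {perm {set {ffun 'I_5 -> gT}}}}),
          [/\ cyclic N1 /\ #|N1| = 3%N, cyclic N2 /\ #|N2| = 3%N, N1 \x N2 = N,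
              K \isog 'Q_8 /\ N ><| K = H &
              (cyclic L /\ #|L| = 3%N) /\ H ><| L = rhoB Z]) /\
      genus Z = 0%R.
Proof.
move=> ntG trivZ defG ow braid C D sigma.
set w := s1 * s2 * s1 in ow braid; set y := s2 * s1.
have w2 : w ^+ 2 = 1 by rewrite -ow expg_order.
(* Regrouping, [y ^+ 3] is [(s2 s1 s2)(s1 s2 s1)], which the braid relation turns into [w ^+ 2]. *)
have y3 : y ^+ 3 = 1.
  by rewrite -w2 -[y ^+ 3]/(y * (y * y)) -[w ^+ 2]/(w * w) {1}braid /w /y !mulgA.
have s1E : s1 = w * y ^+ 2.
  by apply: (mulIg y); rewrite -mulgA -expgSr y3 mulg1 /w /y mulgA.
(* By the braid relation [y * s2 = w]. *)
have s2E : s2 = y ^+ 2 * w.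
  by apply: (mulgI y); rewrite mulgA -expgS y3 mul1g braid /y.
have defG' : G :=: <<[set w; y]>>.
  apply/eqP; rewrite defG eqEsubset !gen_subG !subUset !sub1set.
  have [s1S s2S] : s1 \in <<[set s1; s2]>> /\ s2 \in <<[set s1; s2]>>.
    by rewrite !mem_gen ?inE ?eqxx ?orbT.
  have [wS yS] : w \in <<[set w; y]>> /\ y \in <<[set w; y]>>.
    by rewrite !mem_gen ?inE ?eqxx ?orbT.
  have s1W : s1 \in <<[set w; y]>> by rewrite s1E groupM ?groupX.
  have s2W : s2 \in <<[set w; y]>> by rewrite s2E groupM ?groupX.
  by rewrite s1W s2W /w /y !groupM.
have ev1 : ev w y [:: true; false; false] = s1.
  by rewrite !ev_cons ev_nil mulg1 [RHS]s1E.
have ev2 : ev w y [:: false; false; true] = s2.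
  by rewrite !ev_cons ev_nil mulg1 mulgA [RHS]s2E.
have ev3 : ev w y [:: false] = y by rewrite ev_cons ev_nil mulg1.
have -> : sigma = rep w y 0.
  apply/ffunP=> -[[|[|[|[|[|k]]]]] k5] //; by rewrite !ffunE /= ?ev1 ?ev2 ?ev3.
rewrite Zorb_rep //.
split; first exact: card_Z.
split; first by apply: rep_Sigma => //; rewrite -s1E.
split; first by move=> i j i1 ij j4; case: (beta_cycle_type3 w2 y3 defG' trivZ ntG i1 ij j4).
split; first by move=> i i1 i5; case: (beta_cycle_type2 w2 y3 defG' trivZ ntG i1 i5).
split; first exact: rhoB_decomposition.
exact: genus_Z.
Qed.
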